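(* Let $\Gamma$ be a finite connected tree with at least two vertices, and choose any vertex $v_*$ as the sink. Then every uniformly large sandpile on $\Gamma$ is immutable.
   Context: $\Gamma$ has vertex set $\mathcal{V}$, and $\mathcal{V}'=\mathcal{V}\setminus\{v_*\}$. For $v\in\mathcal{V}$, $d(v)$ is the degree of $v$ in $\Gamma$ (including edges to the sink). The Laplacian $L$ is the $\mathcal{V}\times\mathcal{V}$ matrix with $L_{vv}=d(v)$ and $L_{vw}=-\#(v,w)$ for $v\ne w$, where $\#(v,w)$ is the number of edges joining $v$ and $w$. The reduced Laplacian $L'$ is the $\mathcal{V}'\times\mathcal{V}'$ matrix obtained from $L$ by deleting the row and column of $v_*$. Inequalities between functions on $\mathcal{V}'$ are pointwise, and constants such as $1$ denote constant functions. A sandpile is a non-negative element of $\mathbb{Z}^{\mathcal{V}'}$; it is uniformly large if $\sigma\ge d-1$. Odometers: for $G\in\{\mathbb{Z},\mathbb{R}\}$ and $\sigma\in\mathbb{Z}^{\mathcal{V}'}$, the $G$-odometer $u_\sigma^G\in G^{\mathcal{V}'}$ is the (existing and unique) element satisfying $\sigma-L'u\le d-1$ and $u\ge 0$ which is minimal, i.e. $u_\sigma^G\le u$ for every $u\in G^{\mathcal{V}'}$ satisfying both inequalities. $\sigma$ is immutable if $u_\sigma^{\mathbb{Z}}=u_\sigma^{\mathbb{R}}$. *)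

(* Defs.v *)
From HB Require Import structures.
From mathcomp Require Import all_boot all_order all_algebra.
From mathcomp Require Import reals.

Set Implicit Arguments.
Unset Strict Implicit.
Unset Printing Implicit Defensive.

Import Order.TTheory GRing.Theory Num.Theory.

Local Open Scope ring_scope.

Record multigraph (V : finType) := Multigraph {
  nedges : V -> V -> nat;
  nedges_sym : forall v w, nedges v w = nedges w v;
  nedges_loopless : forall v, nedges v v = 0%N }.

Definition adj (V : finType) (Gamma : multigraph V) : rel V :=
  fun v w => (0 < nedges Gamma v w)%N.

Definition connected (V : finType) (Gamma : multigraph V) : Prop :=
  forall v w : V, connect (adj Gamma) v w.

(* A pair of parallel edges is a cycle of length two, and is excluded by the
   first clause.  The second clause has to allow [size c = 2], since an edge
   traversed back and forth satisfies [ucycle]. *)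
Definition acyclic (V : finType) (Gamma : multigraph V) : Prop :=
  (forall v w : V, (nedges Gamma v w <= 1)%N) /\
  (forall c : seq V, ucycle (adj Gamma) c -> (size c <= 2)%N).

Definition is_tree (V : finType) (Gamma : multigraph V) : Prop :=
  connected Gamma /\ acyclic Gamma.

Definition degree (V : finType) (Gamma : multigraph V) (v : V) : nat :=
  (\sum_(w : V) nedges Gamma v w)%N.

Definition laplacian (V : finType) (Gamma : multigraph V) (v w : V) : int :=
  if v == w then (degree Gamma v)%:Z else - (nedges Gamma v w)%:Z.

Definition nonsink (V : finType) (s : V) : finType := {v : V | v != s}.

Definition reduced_laplacian (V : finType) (Gamma : multigraph V) (s : V)
    (v w : nonsink s) : int :=
  laplacian Gamma (val v) (val w).

Definition is_sandpile (V : finType) (s : V)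
    (sigma : {ffun nonsink s -> int}) : Prop :=
  forall v : nonsink s, 0 <= sigma v.

Definition uniformly_large (V : finType) (Gamma : multigraph V) (s : V)
    (sigma : {ffun nonsink s -> int}) : Prop :=
  forall v : nonsink s, (degree Gamma (val v))%:Z - 1 <= sigma v.

(* [G] is instantiated with [int] and with the reals; the integer data are
   mapped into it by [_%:~R], which is the identity on [int] (lemma [intz]). *)
Definition stabilizing (G : numDomainType) (V : finType)
    (Gamma : multigraph V) (s : V) (sigma : {ffun nonsink s -> int})
    (u : {ffun nonsink s -> G}) : Prop :=
  (forall v : nonsink s,
     (sigma v)%:~R
       - \sum_(w : nonsink s) (reduced_laplacian Gamma v w)%:~R * u w
     <= (degree Gamma (val v))%:R - 1) /\
  (forall v : nonsink s, 0 <= u v).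

Definition is_odometer (G : numDomainType) (V : finType)
    (Gamma : multigraph V) (s : V) (sigma : {ffun nonsink s -> int})
    (u : {ffun nonsink s -> G}) : Prop :=
  stabilizing Gamma sigma u /\
  (forall u' : {ffun nonsink s -> G}, stabilizing Gamma sigma u' ->
     forall v : nonsink s, u v <= u' v).

Lemma is_odometer_unique (G : numDomainType) (V : finType)
    (Gamma : multigraph V) (s : V) (sigma : {ffun nonsink s -> int})
    (u1 u2 : {ffun nonsink s -> G}) :
  is_odometer Gamma sigma u1 -> is_odometer Gamma sigma u2 -> u1 = u2.
Proof.
move=> [st1 min1] [st2 min2]; apply/ffunP => v.
by apply/le_anti; rewrite min1 // min2.
Qed.

(* The odometers are referred to through existential quantifiers, so that
   immutability asserts that both exist; they are unique by
   [is_odometer_unique]. *)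
Definition immutable (R : realType) (V : finType) (Gamma : multigraph V)
    (s : V) (sigma : {ffun nonsink s -> int}) : Prop :=
  exists (uZ : {ffun nonsink s -> int}) (uR : {ffun nonsink s -> R}),
    [/\ is_odometer Gamma sigma uZ,
        is_odometer Gamma sigma uR
      & [ffun v => (uZ v)%:~R] = uR].

(* Main.v *)
Require Import Defs.
From HB Require Import structures.
From mathcomp Require Import all_boot all_order all_algebra.
From mathcomp Require Import reals.

Import Order.TTheory GRing.Theory Num.Theory.

Local Open Scope ring_scope.

(** A uniformly large sandpile has non-negative excess [b = sigma - (d - 1)],
    and stabilizing it means finding [u >= 0] with [L' u >= b].  The reduced
    Laplacian of a connected graph obeys a minimum principle: [L' u >= 0]
    forces [u >= 0].  Hence a solution of [L' u = b] is automatically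
    non-negative and lies below every stabilizing function, so it is the
    odometer, over the integers and over the reals alike
    ([is_odometer_of_exact]).  This uses the connectedness of the graph only.

    What a tree adds is that [L' u = b] is solvable over the integers for every
    integral [b] ([tree_poisson]).  One could quote the matrix-tree theorem,
    which gives determinant 1 for [L'], but there is an explicit reason:
    removing the edge [{v, p}] separates [v] from [p], and since that edge is
    the only one to leave the component [D] of [v], the Laplacian of the
    indicator of [D] is a unit source at [v] and a unit sink at [p]
    ([tree_edge_dipole]).  Adding these along a path gives an integral potential
    with a unit source at [v] and a unit sink at [s], for every [v], and
    integral combinations of those realize every prescribed [b] off [s]. *)

(** * Exact solutions are odometers *)

(** The full Laplacian in difference form, on potentials defined on all
    vertices: differences make its invariance under constants and the minimum
    principle immediate. *)
Definition lap {G : pzRingType} {V : finType} (Gamma : multigraph V)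
    (f : V -> G) (x : V) : G :=
  \sum_w (f x - f w) * (nedges Gamma x w)%:R.

Definition extend0 {G : pzRingType} {V : finType} {s : V}
    (u : {ffun nonsink s -> G}) (x : V) : G :=
  if insub x is Some v then u v else 0.

Lemma extend0_val (G : pzRingType) (V : finType) (s : V)
    (u : {ffun nonsink s -> G}) (v : nonsink s) : extend0 u (val v) = u v.
Proof. by rewrite /extend0 valK. Qed.

Lemma extend0_sink (G : pzRingType) (V : finType) (s : V)
    (u : {ffun nonsink s -> G}) : extend0 u s = 0.
Proof. by rewrite /extend0 insubF ?eqxx. Qed.

Section Laplacian.

Variables (V : finType) (Gamma : multigraph V).

Lemma lapB (G : pzRingType) (f g : V -> G) x :
  lap Gamma (fun y => f y - g y) x = lap Gamma f x - lap Gamma g x.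
Proof.
rewrite /lap -sumrB; apply: eq_bigr => w _.
by rewrite -mulrBl !opprD opprK addrACA.
Qed.

Lemma lapD (G : pzRingType) (f g : V -> G) x :
  lap Gamma (fun y => f y + g y) x = lap Gamma f x + lap Gamma g x.
Proof.
rewrite /lap -big_split; apply: eq_bigr => w _ /=.
by rewrite -mulrDl opprD addrACA.
Qed.

Lemma lapDc (G : pzRingType) (f : V -> G) c x :
  lap Gamma (fun y => f y + c) x = lap Gamma f x.
Proof.
by apply: eq_bigr => w _; rewrite opprD addrACA subrr addr0.
Qed.

Lemma lap_sum (G : pzRingType) (I : finType) (a : I -> G) (f : I -> V -> G) x :
  lap Gamma (fun y => \sum_i a i * f i y) x = \sum_i a i * lap Gamma (f i) x.
Proof.
under [RHS]eq_bigr do rewrite mulr_sumr.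
rewrite exchange_big; apply: eq_bigr => w _ /=.
rewrite -sumrB mulr_suml; apply: eq_bigr => i _.
by rewrite -mulrBr mulrA.
Qed.

Lemma lap_intr (G : pzRingType) (f : V -> int) x :
  lap Gamma (fun y => (f y)%:~R) x = (lap Gamma f x)%:~R :> G.
Proof.
rewrite /lap rmorph_sum /=; apply: eq_bigr => w _.
by rewrite rmorphM rmorphB /= rmorph_nat.
Qed.

Lemma reduced_laplacianE (G : numDomainType) (s : V) (f : V -> G)
    (v : nonsink s) : f s = 0 ->
  \sum_(w : nonsink s) (reduced_laplacian Gamma v w)%:~R * f (val w)
    = lap Gamma f (val v).
Proof.
move=> fs0; rewrite /reduced_laplacian.
rewrite -(big_sub [pred x | x != s]
  (fun x => (laplacian Gamma (val v) x)%:~R * f x)) /=.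
transitivity (\sum_x (laplacian Gamma (val v) x)%:~R * f x).
  by rewrite [RHS](bigD1 s) //= fs0 mulr0 add0r.
rewrite /lap; under [RHS]eq_bigr do rewrite mulrBl.
rewrite sumrB -mulr_sumr -natr_sum (bigD1 (val v)) //= {1}/laplacian eqxx.
rewrite -pmulrn [X in X + _]mulrC; congr (_ + _).
rewrite [in RHS](bigD1 (val v)) //= nedges_loopless mulr0 add0r -sumrN.
apply: eq_bigr => w /negbTE nwv.
by rewrite /laplacian eq_sym nwv rmorphN /= -pmulrn mulNr mulrC.
Qed.

(** At a vertex where [f] is minimal all the terms of [lap f] are
    non-positive; if their sum is non-negative they vanish, so that the neighbours
    are minimal as well.  Minimality thus spreads along a path to [s]. *)
Lemma min_principle (G : realDomainType) (s : V) (f : V -> G) :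
  connected Gamma -> (forall x, x != s -> 0 <= lap Gamma f x) ->
  forall x, f s <= f x.
Proof.
move=> con sup; case: (@arg_minP _ _ _ s xpredT f isT) => m _ min_m.
suff -> : f s = f m by move=> x; apply: min_m.
have /connectP[p] := con m s.
elim: p m min_m => [|y p IHp] m min_m /=; first by move=> _ ->.
move=> /andP[my py] lst; have [-> // | nms] := eqVneq m s.
suff fym : f y = f m by rewrite -fym; apply: IHp => // z _; rewrite fym min_m.
have term_ge0 w : true -> 0 <= (f w - f m) * (nedges Gamma m w)%:R.
  by move=> _; rewrite mulr_ge0 ?subr_ge0 ?min_m.
have sum_eq0 : \sum_w (f w - f m) * (nedges Gamma m w)%:R = 0.
  apply/le_anti; rewrite sumr_ge0 // andbT -oppr_ge0 -sumrN.
  rewrite (le_trans (sup m nms)) // le_eqVlt; apply/orP; left; apply/eqP.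
  by apply: eq_bigr => w _; rewrite -mulNr opprB.
move/eqP: sum_eq0; rewrite psumr_eq0 // => /allP/(_ y (mem_index_enum y)).
move: my; rewrite /adj lt0n => my.
by rewrite mulf_eq0 pnatr_eq0 (negbTE my) orbF subr_eq0 => /eqP.
Qed.

(** Two uses of the minimum principle: on [f] itself, whose Laplacian is the
    non-negative excess, and on the difference between a competitor and [f]. *)
Lemma is_odometer_of_exact (G : realDomainType) (s : V)
    (sigma : {ffun nonsink s -> int}) (f : V -> G) :
  connected Gamma -> uniformly_large Gamma sigma -> f s = 0 ->
  (forall v : nonsink s, lap Gamma f (val v)
     = (sigma v)%:~R - ((degree Gamma (val v))%:R - 1)) ->
  is_odometer Gamma sigma [ffun v => f (val v)].
Proof.
move=> con large fs0 fE; split; first split.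
- move=> v; under eq_bigr do rewrite ffunE.
  by rewrite reduced_laplacianE // fE subKr.
- move=> v; rewrite ffunE -fs0; apply: min_principle => // x xs.
  rewrite (fE (Sub x xs)) subr_ge0.
  by have := large (Sub x xs); rewrite -(ler_int G) rmorphB /= -pmulrn.
- move=> u' [st' _] v; rewrite ffunE.
  suff : extend0 u' s - f s <= extend0 u' (val v) - f (val v).
    by rewrite extend0_sink fs0 subrr extend0_val subr_ge0.
  apply: (min_principle _ s (fun y => extend0 u' y - f y)) => // x xs.
  rewrite lapB (fE (Sub x xs)) subr_ge0 lerBlDr addrC -lerBlDr.
  have := st' (Sub x xs); under eq_bigr do rewrite -extend0_val.
  by rewrite reduced_laplacianE ?extend0_sink.
Qed.

(** * Integral potentials on a tree *)

Definition adj_minus (v p : V) : rel V := fun x y =>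
  adj Gamma x y && ~~ ((x == v) && (y == p) || (x == p) && (y == v)).

Lemma adj_sym : symmetric (adj Gamma).
Proof. by move=> x y; rewrite /adj nedges_sym. Qed.

Lemma adj_minus_sym v p : symmetric (adj_minus v p).
Proof.
by move=> x y; rewrite /adj_minus adj_sym orbC (andbC (x == p)) (andbC (x == v)).
Qed.

(** A simple path from [v] to [p] avoiding the edge between them closes up,
    through that edge, to a cycle, which has at least three vertices because
    its first step is not the avoided edge. *)
Lemma tree_edge_cut v p :
  acyclic Gamma -> adj Gamma v p -> ~~ connect (adj_minus v p) v p.
Proof.
move=> [_ acyc] vp; apply/negP => /connectP[q0 pq0 lst].
case/shortenP: pq0 lst => q pq uq _ lst.
have pq' : path (adj Gamma) v q by apply: sub_path pq => x y /andP[].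
have : ucycle (adj Gamma) (v :: q).
  by rewrite /ucycle uq andbT /= rcons_path pq' -lst adj_sym.
move/acyc; case: q pq lst {uq pq'} => [|y [|//]] /=.
  by move=> _ pv _; move: vp; rewrite pv /adj nedges_loopless.
move=> + py _; rewrite andbT.
by rewrite /adj_minus -py !eqxx andbF.
Qed.

(** The indicator of the component of [v] after removal of the edge to [p]:
    its only non-zero difference along an edge is across the removed one. *)
Lemma tree_edge_dipole v p : acyclic Gamma -> adj Gamma v p ->
  exists f : V -> int,
    forall x, lap Gamma f x = (x == v)%:R - (x == p)%:R.
Proof.
move=> acyc vp; set D := connect (adj_minus v p) v.
have Dv : D v by apply: connect0.
have /negbTE Dp : ~~ D p by apply: tree_edge_cut.
have n1 : nedges Gamma v p = 1%N.
  by apply/anti_leq/andP; split; [exact: acyc.1 | exact: vp].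
have nvp : (v == p) = false by apply: contraTF Dv => /eqP->; rewrite Dp.
exists (fun x => (D x)%:R) => x.
transitivity (\sum_w (((x == v) && (w == p))%:R
                      - ((x == p) && (w == v))%:R : int)).
  apply: eq_bigr => w _.
  have [/andP[/eqP-> /eqP->] | xw1] := boolP ((x == v) && (w == p)).
    by rewrite Dv Dp n1 nvp.
  have [/andP[/eqP-> /eqP->] | xw2] := boolP ((x == p) && (w == v)).
    by rewrite Dv Dp nedges_sym n1.
  rewrite subrr; have [-> | nxw] := posnP (nedges Gamma x w).
    by rewrite mulr0.
  suff -> : D x = D w by rewrite subrr mul0r.
  apply: (same_connect_r (sym_connect_sym (adj_minus_sym v p))).
  by apply: connect1; rewrite /adj_minus /adj nxw negb_or xw1 xw2.
have sum_delta (b : bool) (y : V) :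
    \sum_w ((b && (w == y))%:R : int) = b%:R.
  rewrite (bigD1 y) //= eqxx andbT big1 ?addr0 // => w /negbTE->.
  by rewrite andbF.
by rewrite sumrB !sum_delta.
Qed.

Lemma tree_dipole v w : is_tree Gamma ->
  exists f : V -> int,
    forall x, lap Gamma f x = (x == v)%:R - (x == w)%:R.
Proof.
move=> [con acyc]; have /connectP[p] := con v w.
elim: p v => [|y p IHp] v /=.
  move=> _ ->; exists (fun=> 0) => x.
  by rewrite subrr /lap big1 // => z _; rewrite subrr mul0r.
move=> /andP[vy py] lst.
have [f fE] := IHp y py lst; have [g gE] := tree_edge_dipole v y acyc vy.
exists (fun x => g x + f x) => x.
by rewrite lapD gE fE addrA subrK.
Qed.

Lemma tree_poisson (s : V) (b : V -> int) : is_tree Gamma ->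
  exists2 f : V -> int, f s = 0 & forall x, x != s -> lap Gamma f x = b x.
Proof.
move=> tree; have [g gE] := fin_all_exists (fun v => tree_dipole v s tree).
pose f x := \sum_v b v * g v x.
exists (fun x => f x + - f s) => [|x /negbTE xs]; first exact: subrr.
rewrite lapDc lap_sum (bigD1 x) //= gE eqxx xs subr0 mulr1.
rewrite big1 ?addr0 // => v /negbTE vx.
by rewrite gE xs eq_sym vx subr0 mulr0.
Qed.

End Laplacian.

Theorem theorem5p1 (R : realType) (V : finType) (Gamma : multigraph V)
    (s : V) (sigma : {ffun nonsink s -> int}) :
  is_tree Gamma ->
  (1 < #|V|)%N ->
  is_sandpile sigma ->
  uniformly_large Gamma sigma ->
  immutable R Gamma sigma.
Proof.
move=> tree _ _ large; have con := tree.1.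
pose b x : int := extend0 sigma x - ((degree Gamma x)%:R - 1).
have [f fs0 fE] := tree_poisson _ Gamma s b tree.
have fE' (v : nonsink s) :
    lap Gamma f (val v) = sigma v - ((degree Gamma (val v))%:R - 1).
  by rewrite fE ?(valP v) // /b extend0_val.
exists [ffun v => f (val v)], [ffun v => (f (val v))%:~R]; split.
- by apply: is_odometer_of_exact => // v; rewrite fE' intz.
- apply: (is_odometer_of_exact _ _ _ _ _ (fun x => (f x)%:~R)) => //.
    by rewrite fs0.
  by move=> v; rewrite lap_intr fE' !rmorphB /= rmorph_nat.
- by apply/ffunP => v; rewrite !ffunE.
Qed.
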